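(* Let $X$ be a continuous vector field on $\mathbb{S}^1$, and let $\lambda$ be the infinitesimal earthquake measure of a left (or right) infinitesimal earthquake extending continuously to $X$, i.e. $\lambda=\lambda^-$ (resp. $\lambda=\lambda^+$) as defined below. Then $$\frac{1-\tanh(1)}{2\sqrt2}\,\lVert\lambda\rVert_{\mathrm{Th}}\le w(X)\le\frac83\lVert X\rVert_{cr}.$$
   Context: Notation: $\mathbb{R}^{1,2}$ is $\mathbb{R}^3$ with $\langle x,y\rangle=-x_0y_0+x_1y_1+x_2y_2$; $\mathbb{H}^2$ is identified with the Klein disk $\mathbb{D}^2$ via $\Pi(x_0,x_1,x_2)=(x_1/x_0,x_2/x_0)$, with ideal boundary $\mathbb{S}^1$. A vector field $X$ on $\mathbb{S}^1$ is written $X(z)=iz\,\phi_X(z)$ with $\phi_X:\mathbb{S}^1\to\mathbb{R}$ its support function. For $\phi:\mathbb{S}^1\to\mathbb{R}$ and $\eta\in\overline{\mathbb{D}^2}$ set $\phi^-(\eta)=\sup\{a(\eta): a:\mathbb{R}^2\to\mathbb{R}\text{ affine}, a|_{\mathbb{S}^1}\le\phi\}$ and $\phi^+(\eta)=\inf\{a(\eta): a\text{ affine}, a|_{\mathbb{S}^1}\ge\phi\}$. Width: $w(X)=\sup_{\eta\in\mathbb{D}^2}\frac{\phi_X^+(\eta)-\phi_X^-(\eta)}{\sqrt{1-|\eta|^2}}\in[0,+\infty]$. For $\sigma\in\mathbb{R}^{1,2}$ let $P_\sigma=\{(\eta,t)\in\mathbb{D}^2\times\mathbb{R}: t=\langle(1,\eta),\sigma\rangle\}$.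 Let $\Sigma^-(\eta)$ be the set of $\sigma$ with $\langle(1,\xi),\sigma\rangle\le\phi_X^-(\xi)$ for all $\xi\in\mathbb{D}^2$ and equality at $\xi=\eta$ (support planes of the graph of $\phi_X^-$ at $\eta$), and $\Sigma^+(\eta)$ likewise with $\ge\phi_X^+$. For $\sigma$ with $P_\sigma$ a support plane of the graph of $\phi_X^\pm$ at some point, let $S^\pm(\sigma)=\{\eta\in\mathbb{D}^2:\phi_X^\pm(\eta)=\langle(1,\eta),\sigma\rangle\}$; the geodesic lamination $\lambda^\pm$ consists of the connected components of $S^\pm(\sigma)\setminus\mathrm{Int}\,S^\pm(\sigma)$ over all such $\sigma$. Its (bending) measure: for an arc $c:[0,1]\to\mathbb{D}^2$, $\lambda^\pm(c)=\inf\sum_{i=0}^{n-1}\sqrt{\langle\sigma_i-\sigma_{i+1},\sigma_i-\sigma_{i+1}\rangle}$ over all $0=t_0<\dots<t_n=1$ and $\sigma_i\in\Sigma^\pm(c(t_i))$. The infinitesimal earthquake measure of a left (resp. right) infinitesimal earthquake extending continuously to $X$ is $\lambda^-$ (resp. $\lambda^+$). The Thurston norm is $\lVert\lambda\rVert_{\mathrm{Th}}=\sup_I\lambda(I)$ over geodesic segments $I$ of hyperbolic length $1$ transverse to the support of $\lambda$. Cross-ratio norm: identify $\mathbb{S}^1$ with $\mathbb{RP}^1=\mathbb{R}\cup\{\infty\}$ by a projective (Möbius) identification and write $X$ as $X(x)\partial_x$. For $Q=[a,b,c,d]$ set $\mathrm{cr}(Q)=\frac{(b-a)(d-c)}{(c-b)(d-a)}$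 and $X[Q]=\frac{X(b)-X(a)}{b-a}-\frac{X(c)-X(b)}{c-b}+\frac{X(d)-X(c)}{d-c}-\frac{X(a)-X(d)}{a-d}$; then $\lVert X\rVert_{cr}=\sup_{\mathrm{cr}(Q)=1}|X[Q]|\in[0,+\infty]$. Infinitesimal earthquakes: a left (resp. right) infinitesimal earthquake along a geodesic lamination is a vector field on $\mathbb{H}^2$ equal to a Killing field on each stratum, such that the difference of the Killing fields of any two strata $S,S'$ is zero only if one is in the closure of the other, and otherwise is a hyperbolic Killing field whose axis weakly separates $S,S'$ and which translates to the left (resp. right) seen from $S$ to $S'$; it extends continuously to $X$ if $\mathcal{E}(\eta_n)\to X(z)$ whenever $\eta_n\to z\in\mathbb{S}^1$. *)

(* Defs.v *)
From HB Require Import structures.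
From mathcomp Require Import all_boot all_order all_algebra.
From mathcomp Require Import all_classical all_reals all_analysis.
Set Implicit Arguments. Unset Strict Implicit. Unset Printing Implicit Defensive.
Import Order.TTheory GRing.Theory Num.Theory.
Import numFieldNormedType.Exports.
Local Open Scope classical_set_scope.
Local Open Scope ring_scope.

Section Defs.
Variable R : realType.

(** Euclidean plane R^2 as [R * R]; Minkowski space R^{1,2} as [R * R * R],
    the triple ((x0, x1), x2). *)
Definition sqn2 (p : R * R) : R := p.1 ^+ 2 + p.2 ^+ 2.
Definition S1 : set (R * R) := [set p | sqn2 p = 1].
Definition D2 : set (R * R) := [set p | sqn2 p < 1].

Definition tanhR (x : R) : R := (expR x - expR (- x)) / (expR x + expR (- x)).
Definition coshR (x : R) : R := (expR x + expR (- x)) / 2.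

Definition affine_fun (a : R * R -> R) : Prop :=
  exists alpha b1 b2 : R, forall p, a p = alpha + b1 * p.1 + b2 * p.2.

(** A (continuous) vector field X on S^1 is given by its support function
    phi_X (only its values on S1 matter): X(z) = i z phi_X(z). *)
Definition phi_minus (phi : R * R -> R) (eta : R * R) : R :=
  sup [set a eta | a in [set a | affine_fun a /\ forall z, S1 z -> a z <= phi z]].
Definition phi_plus (phi : R * R -> R) (eta : R * R) : R :=
  inf [set a eta | a in [set a | affine_fun a /\ forall z, S1 z -> phi z <= a z]].

Definition width (phi : R * R -> R) : \bar R :=
  ereal_sup [set ((phi_plus phi eta - phi_minus phi eta)
                    / Num.sqrt (1 - sqn2 eta))%:E | eta in D2].

(** <(1,eta), sigma> in R^{1,2} *)
Definition lp (eta : R * R) (s : R * R * R) : R :=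
  - s.1.1 + eta.1 * s.1.2 + eta.2 * s.2.
Definition mink_dist2 (s s' : R * R * R) : R :=
  - (s.1.1 - s'.1.1) ^+ 2 + (s.1.2 - s'.1.2) ^+ 2 + (s.2 - s'.2) ^+ 2.

Definition Sigma_minus (phi : R * R -> R) (eta : R * R) : set (R * R * R) :=
  [set s | (forall xi, D2 xi -> lp xi s <= phi_minus phi xi)
           /\ lp eta s = phi_minus phi eta].
Definition Sigma_plus (phi : R * R -> R) (eta : R * R) : set (R * R * R) :=
  [set s | (forall xi, D2 xi -> phi_plus phi xi <= lp xi s)
           /\ lp eta s = phi_plus phi eta].

(** [left = true]: lambda^- (left earthquake); [left = false]: lambda^+. *)
Definition Sigma_pm (left : bool) phi :=
  if left then Sigma_minus phi else Sigma_plus phi.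
Definition phi_pm (left : bool) phi :=
  if left then phi_minus phi else phi_plus phi.

Definition Sset (f : R * R -> R) (s : R * R * R) : set (R * R) :=
  [set eta | D2 eta /\ f eta = lp eta s].

Definition leaves (left : bool) (phi : R * R -> R) : set (set (R * R)) :=
  [set L | exists s, (exists eta, D2 eta /\ Sigma_pm left phi eta s) /\
     let B := Sset (phi_pm left phi) s `\` (Sset (phi_pm left phi) s)° in
     exists x, B x /\ L = connected_component B x].

Definition bending (left : bool) (phi : R * R -> R) (c : R -> R * R) : \bar R :=
  ereal_inf [set v | exists (n : nat) (t : nat -> R) (sg : nat -> R * R * R),
    [/\ t 0%N = 0, t n = 1, (forall i, (i < n)%N -> t i < t i.+1),
        (forall i, (i <= n)%N -> Sigma_pm left phi (c (t i)) (sg i)) &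
        v = (\sum_(0 <= i < n) Num.sqrt (mink_dist2 (sg i) (sg i.+1)))%:E]].

(** geodesic segments of the Klein model are Euclidean segments *)
Definition segpar (p q : R * R) (t : R) : R * R :=
  (p.1 + t * (q.1 - p.1), p.2 + t * (q.2 - p.2)).
Definition seg (p q : R * R) : set (R * R) :=
  [set segpar p q t | t in [set t : R | 0 <= t <= 1]].
(** cosh of the hyperbolic distance in the Klein model *)
Definition cosh_hdist (p q : R * R) : R :=
  (1 - (p.1 * q.1 + p.2 * q.2)) / Num.sqrt ((1 - sqn2 p) * (1 - sqn2 q)).

Definition transverse (left : bool) phi (I : set (R * R)) : Prop :=
  forall L, leaves left phi L -> forall x y, I x -> I y -> L x -> L y -> x = y.

Definition thurston_norm (left : bool) (phi : R * R -> R) : \bar R :=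
  ereal_sup [set v | exists p q : R * R,
    [/\ D2 p, D2 q, cosh_hdist p q = coshR 1, transverse left phi (seg p q) &
        v = bending left phi (segpar p q)]].

(** Cross-ratio norm, via the projective identification
    x in R |-> (x - i)/(x + i) in S^1, under which X = X(x) d/dx with
    X(x) = (x^2 + 1)/2 * phi_X((x-i)/(x+i)). *)
Definition cayley (x : R) : R * R :=
  ((x ^+ 2 - 1) / (x ^+ 2 + 1), - (2 * x) / (x ^+ 2 + 1)).
Definition Xcoord (phi : R * R -> R) (x : R) : R :=
  (x ^+ 2 + 1) / 2 * phi (cayley x).
Definition cr (a b c d : R) : R := (b - a) * (d - c) / ((c - b) * (d - a)).
Definition Xquad (phi : R * R -> R) (a b c d : R) : R :=
  let X := Xcoord phi in
  (X b - X a) / (b - a) - (X c - X b) / (c - b) + (X d - X c) / (d - c)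
  - (X a - X d) / (a - d).
Definition cr_norm (phi : R * R -> R) : \bar R :=
  ereal_sup [set v | exists a b c d : R, cr a b c d = 1 /\
                       v = (`|Xquad phi a b c d|)%:E].

End Defs.

(* Main.v *)
(** Lower bound.  Let [sigma], [tau] be affine functions with
    [sigma <= phi <= tau] on the circle that are extremal at [p].  Their
    difference is nonnegative on the circle, hence so is
    [2 (tau - sigma) p (1 - p.z) / (1 - |p|^2) - (tau - sigma) z] (a Harnack
    inequality).  So if [sigma0], [sigma1] are extremal at [p], [q] and [w] is
    the width, then [sigma1 - sigma0 + 2 w p] and [2 w q - (sigma1 - sigma0)]
    are future causal vectors of Minkowski space, which bounds
    [<sigma1 - sigma0, sigma1 - sigma0>] by [4 w^2 (1 + 2 cosh d(p, q))].  The
    partition with the two endpoints only is thus already good enough.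

    Upper bound.  On the real line affine functions become polynomials of
    degree at most 2.  Given a point [eta] of the half-plane, subtract one from
    [X] so that [X] vanishes at infinity and at two points symmetric about
    [eta].  The limit of the cross-ratio condition when one point goes to
    infinity is the Zygmund condition [|2 X(x) - X(x-t) - X(x+t)| <= N t],
    which, by halving and doubling, bounds [|X|] by [4/3 N] times the quadratic
    polynomial that represents [eta]. *)
Require Import Defs.
From HB Require Import structures.
From mathcomp Require Import all_boot all_order all_algebra.
From mathcomp Require Import all_classical all_reals all_analysis.
From mathcomp Require Import ring lra.
Set Implicit Arguments. Unset Strict Implicit. Unset Printing Implicit Defensive.
Import Order.TTheory GRing.Theory Num.Theory.
Import numFieldNormedType.Exports.
Local Open Scope classical_set_scope.
Local Open Scope ring_scope.

(** * The future cone of Minkowski space and the distance between planes *)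

Section MinkowskiCone.
Variable R : realType.
Implicit Types (p q z : R * R) (s : R * R * R).

Definition dot2 p q : R := p.1 * q.1 + p.2 * q.2.

Definition future (a0 a1 a2 : R) : Prop := 0 <= a0 /\ a1 ^+ 2 + a2 ^+ 2 <= a0 ^+ 2.

(** Cauchy-Schwarz on the space coordinates, through the Lagrange identity; the cone is self-dual,
    with [nonneg_circle_future] as a converse. *)
Lemma future_dot a0 a1 a2 b0 b1 b2 :
  future a0 a1 a2 -> future b0 b1 b2 -> 0 <= a0 * b0 + a1 * b1 + a2 * b2.
Proof.
move=> [a0_ge0 aP] [b0_ge0 bP].
have ab_ge0 : 0 <= a0 * b0 by rewrite mulr_ge0.
suff : `|a1 * b1 + a2 * b2| <= a0 * b0 by rewrite ler_norml => /andP[]; lra.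
rewrite -ler_sqr ?nnegrE // real_normK ?num_real // exprMn.
have : (a1 ^+ 2 + a2 ^+ 2) * (b1 ^+ 2 + b2 ^+ 2) <= a0 ^+ 2 * b0 ^+ 2.
  by rewrite ler_pM // addr_ge0 // sqr_ge0.
have : 0 <= (a1 * b2 - a2 * b1) ^+ 2 by exact: sqr_ge0.
nra.
Qed.

(** On the circle the affine function is smallest at the unit vector opposite to [(a1, a2)], where
    it equals [a0] minus the length of [(a1, a2)]. *)
Lemma nonneg_circle_future a0 a1 a2 :
  (forall z, S1 z -> 0 <= a0 + a1 * z.1 + a2 * z.2) -> future a0 a1 a2.
Proof.
move=> a_ge0.
have S1e1 : @S1 R (1, 0) by rewrite /S1/= /sqn2/=; ring.
have S1e1N : @S1 R (-1, 0) by rewrite /S1/= /sqn2/=; ring.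
have a0_ge0 : 0 <= a0.
  by have /= := a_ge0 _ S1e1; have /= := a_ge0 _ S1e1N; lra.
split=> //.
set n2 := a1 ^+ 2 + a2 ^+ 2.
have n2_ge0 : 0 <= n2 by rewrite addr_ge0 // sqr_ge0.
have [n2_eq0|n2_neq0] := eqVneq n2 0; first by rewrite n2_eq0 sqr_ge0.
have n_gt0 : 0 < Num.sqrt n2 by rewrite sqrtr_gt0 lt_def n2_neq0.
have nK : Num.sqrt n2 ^+ 2 = n2 by rewrite sqr_sqrtr.
have /a_ge0 /= : @S1 R (- a1 / Num.sqrt n2, - a2 / Num.sqrt n2).
  rewrite /S1/= /sqn2/= !exprMn !sqrrN exprVn nK -mulrDl mulfV //.
have -> : a0 + a1 * (- a1 / Num.sqrt n2) + a2 * (- a2 / Num.sqrt n2) =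
          a0 - Num.sqrt n2.
  have -> : a0 - Num.sqrt n2 = a0 - (Num.sqrt n2) ^+ 2 / Num.sqrt n2.
    by rewrite expr2 mulfK // gt_eqF.
  by rewrite nK /n2; ring.
rewrite subr_ge0 => n_le; rewrite -nK ler_sqr ?nnegrE //; exact: ltW.
Qed.

(* The chord from [z] through [p] ends at the point [z'] of the circle with
   [2 (1 - p.z) p = (1 - |p|^2) z + |p - z|^2 z'], and [a z' >= 0]. *)
Lemma affine_harnack a0 a1 a2 p z : future a0 a1 a2 -> S1 z ->
  (1 - sqn2 p) * (a0 + a1 * z.1 + a2 * z.2) <=
  2 * (1 - dot2 p z) * (a0 + a1 * p.1 + a2 * p.2).
Proof.
case: p z => p1 p2 [z1 z2]; rewrite /S1/= /sqn2 /dot2/= => aP zP.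
have H := @future_dot a0 a1 a2 ((p1 - z1) ^+ 2 + (p2 - z2) ^+ 2)
   (2 * (1 - (p1 * z1 + p2 * z2)) * p1 - (1 - (p1 ^+ 2 + p2 ^+ 2)) * z1)
   (2 * (1 - (p1 * z1 + p2 * z2)) * p2 - (1 - (p1 ^+ 2 + p2 ^+ 2)) * z2) aP.
have {}H : 0 <= a0 * ((p1 - z1) ^+ 2 + (p2 - z2) ^+ 2) +
   a1 * (2 * (1 - (p1 * z1 + p2 * z2)) * p1 - (1 - (p1 ^+ 2 + p2 ^+ 2)) * z1) +
   a2 * (2 * (1 - (p1 * z1 + p2 * z2)) * p2 - (1 - (p1 ^+ 2 + p2 ^+ 2)) * z2).
  apply: H; split; first by rewrite addr_ge0 // sqr_ge0.
  rewrite le_eqVlt; apply/orP; left; apply/eqP.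
  have E : z1 ^+ 2 = 1 - z2 ^+ 2 by rewrite -zP; ring.
  ring: E.
rewrite -subr_ge0; apply: le_trans H _.
rewrite le_eqVlt; apply/orP; left; apply/eqP.
have E : z1 ^+ 2 = 1 - z2 ^+ 2 by rewrite -zP; ring.
ring: E.
Qed.


Lemma D2_gap p : D2 p -> 0 < 1 - sqn2 p.
Proof. by rewrite /D2/= subr_gt0. Qed.

Lemma dot2_S1 p z : D2 p -> S1 z -> dot2 p z <= 1.
Proof.
case: p z => p1 p2 [z1 z2]; rewrite /D2/= /S1/= /sqn2 /dot2/= => pP zP.
have := sqr_ge0 (p1 - z1); have := sqr_ge0 (p2 - z2).
by rewrite !sqrrB; lra.
Qed.

(** Harnack for the difference of the two planes. As [1 - dot2 p z] is minus the Minkowski product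
    of [(1, p)] and [(1, z)], the bound is minus the product of [(1, z)] with [2 w] times the
    hyperboloid point over [p]. *)
Lemma lp_gap_le p z s t w : D2 p -> S1 z ->
  (forall x, S1 x -> lp x s <= lp x t) ->
  lp p t - lp p s <= w * Num.sqrt (1 - sqn2 p) ->
  lp z t - lp z s <= 2 * w / Num.sqrt (1 - sqn2 p) * (1 - dot2 p z).
Proof.
move=> D2p S1z st gap; have e_gt0 := D2_gap D2p.
have r_gt0 : 0 < Num.sqrt (1 - sqn2 p) by rewrite sqrtr_gt0.
have rK : Num.sqrt (1 - sqn2 p) ^+ 2 = 1 - sqn2 p by rewrite sqr_sqrtr // ltW.
have fut : future (s.1.1 - t.1.1) (t.1.2 - s.1.2) (t.2 - s.2).
  apply: nonneg_circle_future => x /st; rewrite /lp; lra.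
have := affine_harnack p fut S1z.
have -> : s.1.1 - t.1.1 + (t.1.2 - s.1.2) * z.1 + (t.2 - s.2) * z.2 =
  lp z t - lp z s by rewrite /lp; ring.
have -> : s.1.1 - t.1.1 + (t.1.2 - s.1.2) * p.1 + (t.2 - s.2) * p.2 =
  lp p t - lp p s by rewrite /lp; ring.
move=> H; rewrite -(ler_pM2l e_gt0); apply: le_trans H _.
have -> : (1 - sqn2 p) * (2 * w / Num.sqrt (1 - sqn2 p) * (1 - dot2 p z)) =
  2 * (1 - dot2 p z) * (w * Num.sqrt (1 - sqn2 p)).
  by rewrite -[X in X * (2 * w / _ * _)]rK; field; rewrite gt_eqF.
rewrite ler_wpM2l // mulr_ge0 // subr_ge0; exact: dot2_S1.
Qed.

Lemma future_point k p : 0 <= k -> D2 p -> future k (k * p.1) (k * p.2).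
Proof.
move=> k_ge0 D2p; split=> //; rewrite !exprMn -mulrDr ler_piMr ?sqr_ge0 //.
exact: ltW.
Qed.

(* With [P, Q] the multiples by [2 w] of the points [p, q] of the hyperboloid
   and [D = s' - s], both [P + D] and [Q - D] are future causal; hence
   [<D, D> <= <P, P> - 2 <P + D, P> <= - <P, P> - 2 <P, Q>]. *)
Lemma mink_dist2_le p q s s' w : D2 p -> D2 q -> 0 <= w ->
  (forall z, S1 z -> lp z s' - lp z s <=
     2 * w / Num.sqrt (1 - sqn2 p) * (1 - dot2 p z)) ->
  (forall z, S1 z -> lp z s - lp z s' <=
     2 * w / Num.sqrt (1 - sqn2 q) * (1 - dot2 q z)) ->
  mink_dist2 s s' <= 4 * w ^+ 2 * (1 + 2 * cosh_hdist p q).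
Proof.
move=> D2p D2q w_ge0 Hp Hq.
have p_gt0 := D2_gap D2p; have q_gt0 := D2_gap D2q.
have rp_gt0 : 0 < Num.sqrt (1 - sqn2 p) by rewrite sqrtr_gt0.
have rq_gt0 : 0 < Num.sqrt (1 - sqn2 q) by rewrite sqrtr_gt0.
set k := 2 * w / Num.sqrt (1 - sqn2 p) in Hp *.
set l := 2 * w / Num.sqrt (1 - sqn2 q) in Hq *.
have k_ge0 : 0 <= k by rewrite divr_ge0 ?mulr_ge0 // ltW.
have l_ge0 : 0 <= l by rewrite divr_ge0 ?mulr_ge0 // ltW.
(* With [P = (k, k p)] and [Q = (l, l q)], the left sides of [kk] and [kl] are [- <P, P>] and
   [- <P, Q>]. *)
have kk : k ^+ 2 * (1 - sqn2 p) = 4 * w ^+ 2.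
  rewrite /k expr_div_n sqr_sqrtr ?(ltW p_gt0) // divfK ?gt_eqF //; ring.
have kl : k * l * (1 - dot2 p q) = 4 * w ^+ 2 * cosh_hdist p q.
  rewrite /k /l /cosh_hdist /dot2 sqrtrM ?(ltW p_gt0) //; field.
  by rewrite !gt_eqF.
pose d0 := s.1.1 - s'.1.1; pose d1 := s'.1.2 - s.1.2; pose d2 := s'.2 - s.2.
(* [F] and [G] are about [P + D] and [Q - D] with space coordinates negated, which turns the
   Euclidean pairing of [future_dot] into minus the Minkowski product. *)
have F : future (k - d0) (- (k * p.1) - d1) (- (k * p.2) - d2).
  by apply: nonneg_circle_future => z /Hp; rewrite /lp /dot2 /d0 /d1 /d2; nra.
have G : future (l + d0) (- (l * q.1) + d1) (- (l * q.2) + d2).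
  by apply: nonneg_circle_future => z /Hq; rewrite /lp /dot2 /d0 /d1 /d2; nra.
have /(future_dot G) := future_point k_ge0 D2p.
case: F => _; rewrite /mink_dist2 => {}F {}G.
move: kk kl; rewrite /sqn2 /dot2 => kk kl.
rewrite (_ : - _ ^+ 2 + _ + _ = d1 ^+ 2 + d2 ^+ 2 - d0 ^+ 2); last first.
  by rewrite /d0 /d1 /d2; ring.
move: (d0) (d1) (d2) F G => {}d0 {}d1 {}d2 F G.
have -> : 4 * w ^+ 2 * (1 + 2 * cosh_hdist p q) =
   4 * w ^+ 2 + 2 * (4 * w ^+ 2 * cosh_hdist p q) by ring.
rewrite -kl -kk; move: F G; rewrite !sqrrB !sqrrN; lra.
Qed.

End MinkowskiCone.

(** * Existence of support planes of the two envelopes *)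

Section SupportPlanes.
Variable R : realType.
Implicit Types (p z xi : R * R) (s : R * R * R) (phi : R * R -> R).

Lemma S1_compact : compact (@S1 R).
Proof.
apply: (@subclosed_compact _ _ (`[-1 : R, 1]%classic `*` `[-1 : R, 1]%classic)).
- apply: (@closed_comp _ _ (@sqn2 R) [set 1]) => [z _|]; last exact: closed_eq.
  apply: cvgD.
    apply: (@continuous_comp _ _ _ fst (fun x : R => x ^+ 2)); first exact: cvg_fst.
    exact: exprn_continuous.
  apply: (@continuous_comp _ _ _ snd (fun x : R => x ^+ 2)); first exact: cvg_snd.
  exact: exprn_continuous.
- by apply: compact_setX; exact: segment_compact.
- move=> [z1 z2]; rewrite /S1/= /sqn2/= !in_itv/= => zP.
  by split; apply/andP; split; nra.
Qed.

Lemma S1_bounded phi : {within @S1 R, continuous phi} ->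
  exists M, forall z, S1 z -> `|phi z| <= M.
Proof.
move=> phic; have S1n0 : @S1 R !=set0 by exists (1, 0); rewrite /S1/= /sqn2/=; ring.
have [x _ xP] := compact_EVT_max S1n0 S1_compact phic.
have [y _ yP] := compact_EVT_min S1n0 S1_compact phic.
exists (`|phi x| + `|phi y|) => z /mem_set Sz.
have := xP _ Sz; have := yP _ Sz.
have := ler_norm (phi x); have := ler_norm (- phi y); rewrite normrN.
have := normr_ge0 (phi x); have := normr_ge0 (phi y).
by rewrite ler_norml; move=> *; apply/andP; split; lra.
Qed.

Lemma affine_funP (a : R * R -> R) :
  affine_fun a <-> exists s, a = @lp R ^~ s.
Proof.
split=> [[c [b1 [b2 aE]]]|[s ->]].
  by exists (- c, b1, b2); apply/funext => x; rewrite aE /lp/=; ring.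
by exists (- s.1.1), s.1.2, s.2 => x; rewrite /lp; ring.
Qed.

(** The coefficients of [M - lp xi s] form a future vector, and so does [(1, xi)]; their pairing is
    nonnegative. *)
Lemma lp_le_disk s M : (forall z, S1 z -> lp z s <= M) ->
  forall xi, D2 xi -> lp xi s <= M.
Proof.
move=> sM xi D2xi.
have fut : future (M + s.1.1) (- s.1.2) (- s.2).
  by apply: nonneg_circle_future => z /sM; rewrite /lp; lra.
have := future_dot fut (future_point ler01 D2xi); rewrite /lp; lra.
Qed.

Lemma phi_minus_ubound phi M xi : (forall z, S1 z -> `|phi z| <= M) -> D2 xi ->
  ubound [set a xi | a in [set a | affine_fun a /\ forall z, S1 z -> a z <= phi z]] M.
Proof.
move=> phiM D2xi _ [_ [/affine_funP[s ->] sphi] <-].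
apply: lp_le_disk D2xi => z S1z; apply: le_trans (sphi _ S1z) _.
exact: le_trans (ler_norm _) (phiM _ S1z).
Qed.

Lemma lp_le_phi_minus phi M s xi : (forall z, S1 z -> `|phi z| <= M) -> D2 xi ->
  (forall z, S1 z -> lp z s <= phi z) -> lp xi s <= phi_minus phi xi.
Proof.
move=> phiM D2xi sphi; apply: ub_le_sup.
  by exists M; exact: phi_minus_ubound.
by exists (@lp R ^~ s) => //; split => //; apply/affine_funP; exists s.
Qed.

Lemma lp_continuous xi : continuous (lp xi : R * R * R -> R).
Proof.
move=> s; rewrite /lp; apply: cvgD; [apply: cvgD|].
- apply: cvgN; apply: (@continuous_comp _ _ _ fst fst); exact: cvg_fst.
- apply: cvgM; [exact: cvg_cst|].
  apply: (@continuous_comp _ _ _ fst snd); [exact: cvg_fst|exact: cvg_snd].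
- apply: cvgM; [exact: cvg_cst|exact: cvg_snd].
Qed.

(** By Harnack, the affine functions below [phi] that are not too low at [p] are uniformly bounded
    on the circle, so their coefficients form a compact set, on which the value at [p] has a
    maximum. *)
Lemma phi_minus_attained phi M p : (forall z, S1 z -> `|phi z| <= M) -> D2 p ->
  exists2 s, (forall z, S1 z -> lp z s <= phi z) & lp p s = phi_minus phi p.
Proof.
move=> phiM D2p.
(* The cut at [- M] does not change the supremum, since the constant [- M], with triple [(M, 0, 0)],
   lies below [phi]. *)
pose E := [set s : R * R * R | (forall z, S1 z -> lp z s <= phi z) /\ - M <= lp p s].
have phi_ge z : S1 z -> - M <= phi z by move/phiM; rewrite ler_norml => /andP[].
have phi_le z : S1 z -> phi z <= M by move/phiM; rewrite ler_norml => /andP[].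
have constE : E (M, 0, 0).
  by split=> [z /phi_ge|]; rewrite /lp/= !mulr0 !addr0.
have e_gt0 := D2_gap D2p.
(* Harnack for [M - lp z s], with [1 - dot2 p z <= 2] and [M - lp p s <= 2 * M]. *)
pose K := M + 4 * (2 * M) / (1 - sqn2 p).
have S1e1 : @S1 R (1, 0) by rewrite /S1/= /sqn2/=; ring.
have S1e1N : @S1 R (-1, 0) by rewrite /S1/= /sqn2/=; ring.
have S1e2 : @S1 R (0, 1) by rewrite /S1/= /sqn2/=; ring.
have S1e2N : @S1 R (0, -1) by rewrite /S1/= /sqn2/=; ring.
have M_ge0 : 0 <= M by apply: le_trans (phiM _ S1e1); exact: normr_ge0.
have K_ge : M <= K by rewrite /K lerDl divr_ge0 ?(ltW e_gt0) ?mulr_ge0.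
have lpK s z : E s -> S1 z -> - K <= lp z s <= K.
  move=> [sphi sp] S1z; have sM x : S1 x -> lp x s <= M.
    by move=> S1x; apply: le_trans (sphi _ S1x) (phi_le _ S1x).
  apply/andP; split; last exact: le_trans (sM _ S1z) K_ge.
  have fut : future (M + s.1.1) (- s.1.2) (- s.2).
    by apply: nonneg_circle_future => x /sM; rewrite /lp; lra.
  have := affine_harnack p fut S1z.
  have -> : M + s.1.1 + - s.1.2 * z.1 + - s.2 * z.2 = M - lp z s.
    by rewrite /lp; ring.
  have -> : M + s.1.1 + - s.1.2 * p.1 + - s.2 * p.2 = M - lp p s.
    by rewrite /lp; ring.
  have dotN : - 1 <= dot2 p z.
    have S1zN : S1 (- z.1, - z.2) by move: S1z; rewrite /S1/= /sqn2/= !sqrrN.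
    by have := dot2_S1 D2p S1zN; rewrite /dot2/=; lra.
  have dot1 := dot2_S1 D2p S1z.
  have Ms : 0 <= M - lp p s.
    by rewrite subr_ge0; exact: (lp_le_disk sM).
  move=> H; have {}H : (1 - sqn2 p) * (M - lp z s) <= 4 * (2 * M).
    apply: le_trans H _; apply: (@le_trans _ _ (4 * (M - lp p s))).
      by rewrite ler_wpM2r //; lra.
    lra.
  rewrite mulrC -ler_pdivlMr // in H.
  by rewrite /K; lra.
have Ec : compact E.
  apply: (@subclosed_compact _ _ (`[- K, K]%classic `*` `[- K, K]%classic `*` `[- K, K]%classic)).
  - have -> : E = \bigcap_(z in @S1 R) (lp z @^-1` [set y | y <= phi z])
        `&` (lp p @^-1` [set y | - M <= y]).
      by apply/seteqP; split => s.
    apply: closedI.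
      apply: closed_bigI => z _; apply: closed_comp => [s _|]; last exact: closed_le.
      exact: lp_continuous.
    apply: closed_comp => [s _|]; last exact: closed_ge.
    exact: lp_continuous.
  - by apply: compact_setX; [apply: compact_setX|]; exact: segment_compact.
  (* Up to sign, each coordinate is half the sum or difference of the values at two opposite points
     of the circle. *)
  - move=> [[s0 s1] s2] Es; rewrite /= !in_itv/=.
    have /andP[] := lpK _ _ Es S1e1; have /andP[] := lpK _ _ Es S1e1N.
    have /andP[] := lpK _ _ Es S1e2; have /andP[] := lpK _ _ Es S1e2N.
    rewrite /lp/= => *; split; [split|]; apply/andP; split; lra.
have [||s /set_mem[sphi _] sP] := @compact_EVT_max _ _ (lp p) E _ Ec.
- by exists (M, 0, 0).
- by apply: continuous_subspaceT; exact: lp_continuous.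
exists s => //; apply/eqP; rewrite eq_le (lp_le_phi_minus phiM) //=.
apply: ge_sup.
  exists (lp p s), (@lp R ^~ s) => //; split => //; apply/affine_funP; by exists s.
move=> _ [_ [/affine_funP[t ->] tphi] <-].
have [tp|/ltW tp] := leP (- M) (lp p t).
  by apply: sP; apply/mem_set.
apply: le_trans tp _; rewrite -[- M](_ : lp p (M, 0, 0) = _); last first.
  by rewrite /lp/= !mulr0 !addr0.
by apply: sP; apply/mem_set.
Qed.

Definition oppT s : R * R * R := (- s.1.1, - s.1.2, - s.2).

Lemma lp_opp xi s : lp xi (oppT s) = - lp xi s.
Proof. by rewrite /lp /oppT/=; ring. Qed.

(** Negation exchanges the affine functions above [phi] with those below [- phi]; the facts on
    [phi_plus] are obtained from those on [phi_minus] in this way. *)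
Lemma phi_plusE phi xi : phi_plus phi xi = - phi_minus (fun z => - phi z) xi.
Proof.
rewrite /phi_plus /phi_minus /inf; congr (- sup _); apply/seteqP; split.
- move=> _ [_ [_ [/affine_funP[s ->] sphi] <-] <-].
  exists (@lp R ^~ (oppT s)); last by rewrite lp_opp.
  split; first by apply/affine_funP; exists (oppT s).
  by move=> z /sphi; rewrite lp_opp lerN2.
- move=> _ [_ [/affine_funP[s ->] sphi] <-].
  exists (- lp xi s); last by rewrite opprK.
  exists (@lp R ^~ (oppT s)); last by rewrite lp_opp.
  split; first by apply/affine_funP; exists (oppT s).
  by move=> z /sphi; rewrite lp_opp lerNr.
Qed.

Lemma phi_plus_le_lp phi M s xi : (forall z, S1 z -> `|phi z| <= M) -> D2 xi ->
  (forall z, S1 z -> phi z <= lp z s) -> phi_plus phi xi <= lp xi s.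
Proof.
move=> phiM D2xi sphi; rewrite phi_plusE lerNl -lp_opp.
apply: (@lp_le_phi_minus _ M) => // z S1z; first by rewrite normrN phiM.
by rewrite lp_opp lerN2 sphi.
Qed.

Lemma phi_plus_attained phi M p : (forall z, S1 z -> `|phi z| <= M) -> D2 p ->
  exists2 s, (forall z, S1 z -> phi z <= lp z s) & lp p s = phi_plus phi p.
Proof.
move=> phiM D2p.
have phiMN z : S1 z -> `|- phi z| <= M by rewrite normrN; exact: phiM.
have [s sphi sp] := phi_minus_attained phiMN D2p.
exists (oppT s); last by rewrite lp_opp sp phi_plusE.
by move=> z /sphi; rewrite lp_opp lerNr.
Qed.

End SupportPlanes.

(** * Lower bound of the width by the Thurston norm *)

Section ThurstonNorm.
Variable R : realType.
Implicit Types (p q z xi : R * R) (s t : R * R * R) (phi : R * R -> R) (w : R).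

Lemma phi_minus_le_phi_plus phi M xi : (forall z, S1 z -> `|phi z| <= M) ->
  D2 xi -> phi_minus phi xi <= phi_plus phi xi.
Proof.
move=> phiM D2xi; have [s sphi <-] := phi_minus_attained phiM D2xi.
have [t phit <-] := phi_plus_attained phiM D2xi.
have -> : lp xi s = lp xi (s.1.1 - t.1.1, s.1.2 - t.1.2, s.2 - t.2) + lp xi t.
  by rewrite /lp/=; ring.
rewrite gerDr; apply: lp_le_disk D2xi => z S1z.
by have := le_trans (sphi _ S1z) (phit _ S1z); rewrite /lp/=; lra.
Qed.

Lemma width_ge0 phi M : (forall z, S1 z -> `|phi z| <= M) -> (0 <= width phi)%E.
Proof.
move=> phiM; have D20 : @D2 R (0, 0) by rewrite /D2/= /sqn2/= expr0n addr0.
apply: ereal_sup_ge; eexists; first by exists (0, 0); [exact: D20|reflexivity].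
by rewrite lee_fin divr_ge0 ?sqrtr_ge0 // subr_ge0 (phi_minus_le_phi_plus phiM).
Qed.

Lemma width_gap phi w xi : (width phi <= w%:E)%E -> D2 xi ->
  phi_plus phi xi - phi_minus phi xi <= w * Num.sqrt (1 - sqn2 xi).
Proof.
move=> /ereal_supP phiw D2xi.
rewrite -ler_pdivrMr ?sqrtr_gt0 ?D2_gap //.
by rewrite -lee_fin; apply: phiw; exists xi.
Qed.

Lemma mink_dist2C s t : mink_dist2 s t = mink_dist2 t s.
Proof. by rewrite /mink_dist2; ring. Qed.

(** Let [s], [t] be the lower and upper extremal planes at [p], and [s'], [t'] those at [q]. On the
    circle [s' <= phi <= t], so [s' - s <= t - s], which the width at [p] controls; symmetrically at
    [q]. *)
Lemma support_planes_close left phi M w p q :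
  (forall z, S1 z -> `|phi z| <= M) -> 0 <= w -> (width phi <= w%:E)%E ->
  D2 p -> D2 q -> exists s s',
  [/\ Sigma_pm left phi p s, Sigma_pm left phi q s' &
      mink_dist2 s s' <= 4 * w ^+ 2 * (1 + 2 * cosh_hdist p q)].
Proof.
move=> phiM w_ge0 phiw D2p D2q.
have gp := width_gap phiw D2p; have gq := width_gap phiw D2q.
have [s sphi sp] := phi_minus_attained phiM D2p.
have [s' sphi' sp'] := phi_minus_attained phiM D2q.
have [t phit tp] := phi_plus_attained phiM D2p.
have [t' phit' tp'] := phi_plus_attained phiM D2q.
rewrite -sp -tp in gp; rewrite -sp' -tp' in gq.
have Bp z (S1z : S1 z) := lp_gap_le D2p S1z
  (fun x Sx => le_trans (sphi x Sx) (phit x Sx)) gp.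
have Bq z (S1z : S1 z) := lp_gap_le D2q S1z
  (fun x Sx => le_trans (sphi' x Sx) (phit' x Sx)) gq.
case: left.
- exists s, s'; split; rewrite /Sigma_pm.
  + by split=> // xi D2xi; exact: (lp_le_phi_minus phiM).
  + by split=> // xi D2xi; exact: (lp_le_phi_minus phiM).
  + apply: mink_dist2_le => // z S1z.
      apply: le_trans (Bp _ S1z).
      by have := sphi' _ S1z; have := phit _ S1z; lra.
    apply: le_trans (Bq _ S1z).
    by have := sphi _ S1z; have := phit' _ S1z; lra.
- exists t, t'; split; rewrite /Sigma_pm.
  + by split=> // xi D2xi; exact: (phi_plus_le_lp phiM).
  + by split=> // xi D2xi; exact: (phi_plus_le_lp phiM).
  (* For upper planes the order is reversed: at [p] it is [t - t'] that is at most [t - s]. *)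
  + rewrite mink_dist2C; apply: mink_dist2_le => // z S1z.
      apply: le_trans (Bp _ S1z).
      by have := sphi _ S1z; have := phit' _ S1z; lra.
    apply: le_trans (Bq _ S1z).
    by have := sphi' _ S1z; have := phit _ S1z; lra.
Qed.

Lemma bending_le left phi M w p q :
  (forall z, S1 z -> `|phi z| <= M) -> 0 <= w -> (width phi <= w%:E)%E ->
  D2 p -> D2 q ->
  (bending left phi (segpar p q) <=
   (2 * w * Num.sqrt (1 + 2 * cosh_hdist p q))%:E)%E.
Proof.
move=> phiM w_ge0 phiw D2p D2q.
have [s [s' [sp s'q ss']]] := support_planes_close left phiM w_ge0 phiw D2p D2q.
have p0 : segpar p q 0 = p by case: p {D2p sp ss'} => *; rewrite /segpar !mul0r !addr0.
have q1 : segpar p q 1 = q.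
  by case: p q {D2p D2q sp ss' s'q p0} => ? ? [? ?]; rewrite /segpar/=; congr (_, _); ring.
apply: ge_ereal_inf; exists (Num.sqrt (mink_dist2 s s'))%:E; last first.
  have -> : 2 * w * Num.sqrt (1 + 2 * cosh_hdist p q) =
            Num.sqrt (4 * w ^+ 2 * (1 + 2 * cosh_hdist p q)).
    have -> : 4 * w ^+ 2 = (2 * w) ^+ 2 by ring.
    by rewrite sqrtrM ?sqr_ge0 // sqrtr_sqr ger0_norm // mulr_ge0.
  by rewrite lee_fin; exact: ler_wsqrtr.
exists 1%N, (fun n => n%:R), (fun n => if n is 0%N then s else s'); split=> //.
- by move=> [|//] _; exact: ltr01.
- by move=> [|[|//]] _; rewrite ?p0 ?q1.
- by rewrite big_nat1.
Qed.

(* [1 - tanh 1 = 2 / (e ^ 2 + 1)], and [e >= 2] is all that is needed. *)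
Lemma tanh_cosh_bound :
  (1 - tanhR 1) * Num.sqrt (1 + 2 * coshR 1) <= Num.sqrt (2 : R).
Proof.
rewrite /tanhR /coshR expRN; set e := expR 1.
have e_ge2 : 2 <= e by have := expR_ge1Dx (1 : R); rewrite -/e; lra.
have e_gt0 : 0 < e by lra.
have e2_gt0 : 0 < e ^+ 2 + 1 by nra.
have eV_le : e^-1 <= 1 by rewrite invf_le1 //; lra.
have eV_ge0 : 0 <= e^-1 by rewrite invr_ge0 ltW.
have -> : 1 - (e - e^-1) / (e + e^-1) = 2 / (e ^+ 2 + 1).
  by field; rewrite !gt_eqF //= addr_gt0 ?mulr_gt0.
have -> : 1 + 2 * ((e + e^-1) / 2) = 1 + e + e^-1 by field; rewrite gt_eqF.
have t_ge0 : 0 <= 2 / (e ^+ 2 + 1) by rewrite divr_ge0 // ltW.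
rewrite -[X in X * _](ger0_norm t_ge0) -sqrtr_sqr -sqrtrM ?sqr_ge0 //.
apply: ler_wsqrtr; rewrite expr_div_n mulrAC ler_pdivrMr ?exprn_gt0 //.
have : 5 <= e ^+ 2 + 1 by nra.
nra.
Qed.

(** When the width is a real [w], every bending in the supremum is at most
    [2 * w * Num.sqrt (1 + 2 * coshR 1)], and [tanh_cosh_bound] says that the constant brings this
    below [w]. *)
Lemma thurston_norm_le_width left phi M : (forall z, S1 z -> `|phi z| <= M) ->
  (((1 - tanhR 1) / (2 * Num.sqrt 2))%:E * thurston_norm left phi
     <= width phi)%E.
Proof.
move=> phiM; have := width_ge0 phiM.
case wE : (width phi) => [w| |] // w_ge0; last by rewrite leey.
rewrite lee_fin in w_ge0.
have t_gt0 : 0 < 1 - @tanhR R 1.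
  have e_gt0 := expR_gt0 (1 : R); have f_gt0 := expR_gt0 (- 1 : R).
  by rewrite /tanhR subr_gt0 ltr_pdivrMr; lra.
have r2_gt0 : 0 < Num.sqrt (2 : R) by rewrite sqrtr_gt0.
have k_gt0 : 0 < (1 - @tanhR R 1) / (2 * Num.sqrt 2).
  by rewrite divr_gt0 // mulr_gt0.
rewrite -lee_pdivlMl //; apply/ereal_supP => _ [p [q [D2p D2q pq _ ->]]].
rewrite lee_pdivlMl //.
have bw : (bending left phi (segpar p q) <=
    (2 * w * Num.sqrt (1 + 2 * coshR 1))%:E)%E.
  by rewrite -pq; apply: (bending_le _ phiM) => //; rewrite wE.
apply: (le_trans (lee_wpmul2l _ bw)); first by rewrite lee_fin ltW.
rewrite -EFinM lee_fin.
have -> : (1 - tanhR 1) / (2 * Num.sqrt 2) * (2 * w * Num.sqrt (1 + 2 * coshR 1)) =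
  w * ((1 - tanhR 1) * Num.sqrt (1 + 2 * coshR 1)) / Num.sqrt 2.
  by field; rewrite gt_eqF.
by rewrite ler_pdivrMr // ler_wpM2l // tanh_cosh_bound.
Qed.

End ThurstonNorm.

(** * Growth of Zygmund functions that vanish at 0 and 1 *)

Section ZygmundEstimate.
Variable R : realType.
Implicit Types (Y : R -> R) (N B x y t : R).

Definition zygmund N Y := forall x t, 0 < t -> `|2 * Y x - Y (x - t) - Y (x + t)| <= N * t.

(** Centre and step are both [y], so the left neighbour is the zero of [Y]. *)
Lemma zygmund_double N Y y : zygmund N Y -> Y 0 = 0 -> 0 < y ->
  `|2 * Y y - Y (2 * y)| <= N * y.
Proof.
move=> YN Y0 y_gt0; have := YN y y y_gt0.
by rewrite subrr Y0 subr0 (_ : y + y = 2 * y) //; ring.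
Qed.

(* The supremum [M] of [|Y|] satisfies [M <= M / 2 + N / 4]. *)
Lemma zygmund_unit_itv N B Y : zygmund N Y -> 0 <= N -> Y 0 = 0 -> Y 1 = 0 ->
  (forall x, 0 <= x <= 1 -> `|Y x| <= B) ->
  forall x, 0 <= x <= 1 -> `|Y x| <= N / 2.
Proof.
move=> YN N_ge0 Y0 Y1 YB.
pose E := [set `|Y x| | x in [set x | 0 <= x <= 1]].
(* The bound [B] only makes [sup E] a true upper bound; its size does not enter the result. *)
have E_le x : 0 <= x <= 1 -> `|Y x| <= sup E.
  move=> xP; apply: ub_le_sup; last by exists x.
  by exists B => _ [y yP <-]; exact: YB.
have M_ge0 : 0 <= sup E.
  by apply: le_trans (E_le 0 _); rewrite ?normr_ge0 // lexx ler01.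
(* Centre [x] and step its distance to the nearer endpoint, at most 1/2: one neighbour is a zero of
   [Y] and the other stays in the interval. *)
have half x : 0 <= x <= 1 -> `|Y x| <= sup E / 2 + N / 4.
  move=> /andP[x_ge0 x_le1].
  have [->|x_neq0] := eqVneq x 0; first by rewrite Y0 normr0; lra.
  have [->|x_neq1] := eqVneq x 1; first by rewrite Y1 normr0; lra.
  have x_gt0 : 0 < x by rewrite lt_def x_neq0.
  have x_lt1 : x < 1 by rewrite lt_def eq_sym x_neq1.
  have [x2|x2] := leP x (1 / 2).
    have := zygmund_double YN Y0 x_gt0.
    have : `|Y (2 * x)| <= sup E by apply: E_le; apply/andP; split; lra.
    have : N * x <= N * (1 / 2) by rewrite ler_wpM2l.
    rewrite !ler_norml => ? /andP[? ?] /andP[? ?]; apply/andP; split; lra.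
  have t_gt0 : 0 < 1 - x by lra.
  have := YN x _ t_gt0; rewrite (_ : x + (1 - x) = 1) ?Y1; last by ring.
  have : `|Y (x - (1 - x))| <= sup E by apply: E_le; apply/andP; split; lra.
  have : N * (1 - x) <= N * (1 / 2) by rewrite ler_wpM2l //; lra.
  rewrite !ler_norml => ? /andP[? ?] /andP[? ?]; apply/andP; split; lra.
move=> x /E_le /le_trans; apply.
suff : sup E <= sup E / 2 + N / 4 by lra.
apply: ge_sup; first by exists `|Y 0|, 0 => //=; rewrite lexx ler01.
by move=> _ [y yP <-]; exact: half.
Qed.

(** A linear bound on [1, 2] comes from the unit interval, and is then propagated by doubling: first
    to [2, 4], where it becomes the quadratic bound, then by induction to larger [x]. *)
Lemma zygmund_ge1 N B Y : zygmund N Y -> 0 <= N -> Y 0 = 0 -> Y 1 = 0 ->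
  (forall x, 0 <= x <= 2 -> `|Y x| <= B) ->
  forall x, 1 <= x -> `|Y x| <= 2 / 3 * N * (x ^+ 2 - x + 1).
Proof.
move=> YN N_ge0 Y0 Y1 YB.
have Y2 : `|Y 2| <= N.
  by have := zygmund_double YN Y0 ltr01; rewrite !mulr1 Y1 mulr0 sub0r normrN.
(* Subtracting the chord over [1, 2] keeps the Zygmund constant; the chord itself is at most
   [(x - 1) * N]. *)
have on12 x : 1 <= x <= 2 -> `|Y x| <= N * (x - 1 / 2).
  move=> /andP[x_ge1 x_le2].
  pose Z x := Y (1 + x) - x * Y 2.
  have ZN : zygmund N Z.
    move=> v t t_gt0; rewrite /Z.
    rewrite (_ : 1 + (v - t) = 1 + v - t); last by ring.
    rewrite (_ : 1 + (v + t) = 1 + v + t); last by ring.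
    apply: le_trans (YN _ _ t_gt0); rewrite le_eqVlt; apply/orP; left.
    by apply/eqP; congr `|_|; ring.
  have Z0 : Z 0 = 0 by rewrite /Z addr0 Y1 mul0r subrr.
  have Z1 : Z 1 = 0 by rewrite /Z mul1r; have -> : 1 + 1 = 2 :> R by []; rewrite subrr.
  have ZB v : 0 <= v <= 1 -> `|Z v| <= B + N.
    move=> /andP[v_ge0 v_le1]; apply: le_trans (ler_normB _ _) _; apply: lerD.
      by apply: YB; apply/andP; split; lra.
    by rewrite normrM ger0_norm // -[leRHS]mul1r ler_pM.
  have := zygmund_unit_itv ZN N_ge0 Z0 Z1 ZB (x := x - 1).
  rewrite /Z (_ : 1 + (x - 1) = x); last by ring.
  have xY : `|(x - 1) * Y 2| <= (x - 1) * N.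
    by rewrite normrM ger0_norm ?ler_wpM2l //; lra.
  move=> H; have {}H : `|Y x - (x - 1) * Y 2| <= N / 2.
    by apply: H; apply/andP; split; lra.
  move: H xY; rewrite !ler_norml => /andP[? ?] /andP[? ?]; apply/andP; split; lra.
have dbl x : 0 < x -> `|Y x| <= 2 * `|Y (x / 2)| + N * (x / 2).
  move=> x_gt0; have x2_gt0 : 0 < x / 2 by lra.
  have := zygmund_double YN Y0 x2_gt0; rewrite mulrCA divff // mulr1.
  have := ler_norm (Y (x / 2)); have := ler_norm (- Y (x / 2)); rewrite normrN.
  by rewrite !ler_norml => ? ? /andP[? ?]; apply/andP; split; lra.
(* Doubling preserves the quadratic bound only if [2 * x ^+ 2 - 3 * x - 4 >= 0], which fails at 2.
   Here the linear bound is doubled instead, and the resulting inequality is an equality at 2. *)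
have on24 x : 2 <= x <= 4 -> `|Y x| <= 2 / 3 * N * (x ^+ 2 - x + 1).
  move=> /andP[x_ge2 x_le4]; apply: le_trans (dbl x _) _; first by lra.
  have : `|Y (x / 2)| <= N * (x / 2 - 1 / 2) by apply: on12; apply/andP; split; lra.
  have : N * (3 / 2 * x - 1) <= N * (2 / 3 * (x ^+ 2 - x + 1)).
    by rewrite ler_wpM2l //; nra.
  lra.
have onn n : forall x, 2 <= x <= 2 ^+ n.+2 -> `|Y x| <= 2 / 3 * N * (x ^+ 2 - x + 1).
  elim: n => [|n IH] x /andP[x_ge2 x_le].
    by apply: on24; rewrite x_ge2 /=; apply: le_trans x_le _; lra.
  have [x4|x4] := leP x 4; first by apply: on24; rewrite x_ge2.
  apply: le_trans (dbl x _) _; first by lra.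
  have : `|Y (x / 2)| <= 2 / 3 * N * ((x / 2) ^+ 2 - x / 2 + 1).
    by apply: IH; rewrite exprS in x_le; apply/andP; split; lra.
  have : N * (4 / 3 * ((x / 2) ^+ 2 - x / 2 + 1) + x / 2) <=
         N * (2 / 3 * (x ^+ 2 - x + 1)).
    by rewrite ler_wpM2l // -subr_ge0; nra.
  lra.
move=> x x_ge1; have [x_le2|x_gt2] := leP x 2.
  apply: le_trans (on12 x _) _; first by rewrite x_ge1.
  rewrite (mulrC _ N) -mulrA ler_wpM2l // -subr_ge0.
  have := sqr_ge0 (x - 5 / 4); lra.
have [n xn] : exists n, x <= 2 ^+ n.+2.
  exists (Num.truncn x).+1; apply: le_trans (_ : ((Num.truncn x).+1)%:R <= _).
    by apply: ltW; apply: truncnS_gt.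
  rewrite -natrX ler_nat; apply: leq_trans (ltnW (ltn_expl _ (isT : (1 < 2)%N))) _.
  by rewrite leq_exp2l // -addn2 leq_addr.
by apply: (onn n); rewrite (ltW x_gt2).
Qed.

(** On [0, 1], [N / 2] is the minimum of the right-hand side, reached at 1/2. The reflection of [y]
    to [1 - y] swaps the two zeros, fixes the quadratic, and reduces [x < 0] to [x > 1]. *)
Lemma zygmund_le N B Y : zygmund N Y -> 0 <= N -> Y 0 = 0 -> Y 1 = 0 ->
  (forall x, - 1 <= x <= 2 -> `|Y x| <= B) ->
  forall x, `|Y x| <= 2 / 3 * N * (x ^+ 2 - x + 1).
Proof.
move=> YN N_ge0 Y0 Y1 YB x.
have YB2 y : 0 <= y <= 2 -> `|Y y| <= B.
  by move=> /andP[? ?]; apply: YB; apply/andP; split; lra.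
have [x_ge1|x_lt1] := leP 1 x; first exact: zygmund_ge1 YB2 _ _.
have [x_ge0|x_lt0] := leP 0 x.
  apply: (@le_trans _ _ (N / 2)).
    apply: (zygmund_unit_itv (B := B) YN) => //; last by rewrite x_ge0 ltW.
    by move=> y /andP[? ?]; apply: YB; apply/andP; split; lra.
  have : 0 <= N * (x - 1 / 2) ^+ 2 by rewrite mulr_ge0 // sqr_ge0.
  rewrite sqrrB; lra.
pose Z y := Y (1 - y).
have ZN : zygmund N Z.
  move=> v t t_gt0; rewrite /Z; apply: le_trans (YN (1 - v) _ t_gt0).
  rewrite (_ : 1 - (v - t) = 1 - v + t); last by ring.
  rewrite (_ : 1 - (v + t) = 1 - v - t); last by ring.
  by rewrite addrAC.
have -> : Y x = Z (1 - x) by rewrite /Z (_ : 1 - (1 - x) = x) //; ring.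
have -> : x ^+ 2 - x + 1 = (1 - x) ^+ 2 - (1 - x) + 1 by ring.
apply: (zygmund_ge1 (B := B) ZN) => //; rewrite ?/Z ?subr0 ?subrr //.
- by move=> y /andP[? ?]; apply: YB; apply/andP; split; lra.
- by rewrite lerBrDr gerDl ltW.
Qed.

End ZygmundEstimate.

(** * Upper bound of the width by the cross-ratio norm *)

Section CrossRatioNorm.
Variable R : realType.
Implicit Types (z eta : R * R) (phi : R * R -> R) (N x t u : R).

Lemma continuous_pair (f g : R -> R) x :
  f y @[y --> x] --> f x -> g y @[y --> x] --> g x ->
  {for x, continuous (fun y => (f y, g y))}.
Proof. by move=> fc gc; apply: (@cvg_pair _ _ _ _ (nbhs (f x)) (nbhs (g x))). Qed.

Lemma within_S1_comp phi (g : R -> R * R) : {within @S1 R, continuous phi} ->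
  continuous g -> (forall x, S1 (g x)) -> continuous (phi \o g).
Proof.
move=> /subspace_continuousP phic gc gS x A Ap.
have near_gx : \forall y \near g x, S1 y -> A (phi y) := phic _ (gS x) A Ap.
have near_x : \forall y \near x, S1 (g y) -> A (phi (g y)) := gc x _ near_gx.
by apply: (filterS _ near_x) => y; apply; exact: gS.
Qed.

Lemma sqr1_gt0 x : 0 < x ^+ 2 + 1.
Proof. by rewrite ltr_wpDl ?sqr_ge0. Qed.

Lemma cayley_S1 x : S1 (cayley x).
Proof.
rewrite /S1/= /sqn2 /cayley/=; field.
by rewrite gt_eqF // sqr1_gt0.
Qed.

Lemma cayley_surj z : S1 z -> z != (1, 0) -> exists x, z = cayley x.
Proof.
case: z => z1 z2; rewrite /S1/= /sqn2/= => zP zN.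
have z1_neq1 : 1 - z1 != 0.
  apply/eqP => z1E; have z11 : z1 = 1 by lra.
  move: zP zN; rewrite z11 expr1n => /eqP; rewrite -subr_eq0 addrAC subrr add0r.
  by rewrite sqrf_eq0 => /eqP ->; rewrite eqxx.
(* Stereographic projection from [(1, 0)], the image of infinity. *)
exists (- z2 / (1 - z1)); rewrite /cayley.
have E : z2 ^+ 2 = 1 - z1 ^+ 2 by rewrite -zP; ring.
have -> : (- z2 / (1 - z1)) ^+ 2 = (1 + z1) / (1 - z1).
  by rewrite expr_div_n sqrrN E; field.
by congr (_, _); field; rewrite z1_neq1 /=; apply/eqP; lra.
Qed.

(* [Xcoord phi] in the chart [u = 1 / x] at infinity. *)
Definition Xinf phi u : R :=
  (1 + u ^+ 2) / 2 * phi ((1 - u ^+ 2) / (1 + u ^+ 2), - (2 * u) / (1 + u ^+ 2)).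

Lemma Xcoord_inv phi u : u != 0 -> Xcoord phi u^-1 = Xinf phi u / u ^+ 2.
Proof.
move=> u_neq0; have u2 := sqr1_gt0 u.
rewrite /Xcoord /Xinf /cayley.
have -> : (u^-1 ^+ 2 - 1) / (u^-1 ^+ 2 + 1) = (1 - u ^+ 2) / (1 + u ^+ 2).
  by field; rewrite u_neq0 /= [1 + _]addrC gt_eqF.
have -> : - (2 * u^-1) / (u^-1 ^+ 2 + 1) = - (2 * u) / (1 + u ^+ 2).
  by field; rewrite u_neq0 /= [1 + _]addrC gt_eqF.
by field.
Qed.

Lemma Xcoord_continuous phi : {within @S1 R, continuous phi} ->
  continuous (Xcoord phi).
Proof.
move=> phic x; have sqc : (y ^+ 2 @[y --> x] --> x ^+ 2) := @exprn_continuous R 2 x.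
have denc : (y ^+ 2 + 1 @[y --> x] --> x ^+ 2 + 1).
  by apply: cvgD sqc _; exact: cvg_cst.
have cayc : continuous (@cayley R).
  move=> v; have sqv : (y ^+ 2 @[y --> v] --> v ^+ 2) := @exprn_continuous R 2 v.
  have denV : ((y ^+ 2 + 1)^-1 @[y --> v] --> (v ^+ 2 + 1)^-1).
    by apply: cvgV; [rewrite gt_eqF // sqr1_gt0|apply: cvgD sqv (cvg_cst _)].
  apply: (@continuous_pair (fun y => (y ^+ 2 - 1) / (y ^+ 2 + 1))
    (fun y => - (2 * y) / (y ^+ 2 + 1))); apply: cvgM denV.
    exact: cvgB sqv (cvg_cst _).
  by apply: cvgN; apply: cvgM (cvg_cst _) _; exact: cvg_id.
apply: cvgM; first exact: cvgM denc (cvg_cst _).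
exact: (within_S1_comp phic cayc cayley_S1).
Qed.

Lemma Xinf_continuous phi : {within @S1 R, continuous phi} ->
  continuous (Xinf phi).
Proof.
move=> phic x.
have den (v : R) : (1 + y ^+ 2 @[y --> v] --> 1 + v ^+ 2).
  by apply: cvgD; [exact: cvg_cst|exact: exprn_continuous].
have den_neq0 (v : R) : 1 + v ^+ 2 != 0 :> R by rewrite addrC gt_eqF // sqr1_gt0.
pose g u : R * R := ((1 - u ^+ 2) / (1 + u ^+ 2), - (2 * u) / (1 + u ^+ 2)).
have gc : continuous g.
  move=> v; have denV : ((1 + y ^+ 2)^-1 @[y --> v] --> (1 + v ^+ 2)^-1).
    by apply: cvgV; [exact: den_neq0|exact: den].
  apply: (@continuous_pair (fun y => (1 - y ^+ 2) / (1 + y ^+ 2))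
    (fun y => - (2 * y) / (1 + y ^+ 2))); apply: cvgM denV.
    by apply: cvgB; [exact: cvg_cst|exact: exprn_continuous].
  by apply: cvgN; apply: cvgM (cvg_cst _) _; exact: cvg_id.
have gS v : S1 (g v) by rewrite /S1/= /sqn2 /g/=; field; rewrite den_neq0.
apply: cvgM; first exact: cvgM (den x) (cvg_cst _).
exact: (within_S1_comp phic gc gS).
Qed.

Lemma Xquad_le phi N (a b c d : R) : (cr_norm phi <= N%:E)%E ->
  cr a b c d = 1 -> `|Xquad phi a b c d| <= N.
Proof.
by move=> /ereal_supP phiN abcd; rewrite -lee_fin; apply: phiN; exists a, b, c, d.
Qed.

(* Limit of the quadruples [x - t, x, c, 1 / u] of cross-ratio 1 as [u] tends
   to 0, for which [c] tends to [x + t]. *)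
Lemma Xcoord_zygmund phi N : {within @S1 R, continuous phi} ->
  (cr_norm phi <= N%:E)%E ->
  zygmund N (fun x => Xcoord phi x - phi (1, 0) / 2 * x ^+ 2).
Proof.
move=> phic phiN x t t_gt0; have t_neq0 : t != 0 by rewrite gt_eqF.
set X := Xcoord phi.
(* [c u] is the solution [c] of [cr a x c u^-1 = 1], an equation linear in [c]. *)
pose a := x - t; pose den u := 1 - x * u + 2 * t * u.
pose c u := x + t * (1 - x * u) / den u.
have idc : u @[u --> (0 : R)^'] --> (0 : R) by exact: cvg_within.
have lin (k : R) : 1 - k * u @[u --> (0 : R)^'] --> (1 : R).
  rewrite -[X in _ --> X](_ : 1 - k * 0 = _); last by rewrite mulr0 subr0.
  by apply: cvgB (cvg_cst _) _; apply: cvgM (cvg_cst _) idc.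
have denc : den u @[u --> 0^'] --> (1 : R).
  rewrite -[X in _ --> X](_ : 1 + 2 * t * 0 = _); last by rewrite mulr0 addr0.
  by apply: cvgD (lin x) _; apply: cvgM (cvg_cst _) idc.
have dc : c u - x @[u --> 0^'] --> t.
  rewrite -[X in _ --> X](_ : t * 1 / 1 = _); last by rewrite mulr1 divr1.
  under eq_cvg do rewrite /c addrC addKr.
  by apply: cvgM (cvgV (oner_neq0 _) denc); apply: cvgM (cvg_cst _) (lin x).
have cc : c u @[u --> 0^'] --> x + t.
  by apply: cvgD (cvg_cst _) _; move: dc; under eq_cvg do rewrite /c addrC addKr.
have cuc : 1 - c u * u @[u --> 0^'] --> (1 : R).
  rewrite -[X in _ --> X](_ : 1 - (x + t) * 0 = _); last by rewrite mulr0 subr0.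
  by apply: cvgB (cvg_cst _) _; apply: cvgM cc idc.
have Xc : X (c u) @[u --> 0^'] --> X (x + t).
  by apply: continuous_cvg cc; exact: Xcoord_continuous.
have Xi : Xinf phi u @[u --> 0^'] --> phi (1, 0) / 2.
  rewrite -[X in _ --> X](_ : Xinf phi 0 = _); last first.
    by rewrite /Xinf expr0n/= mulr0 oppr0 !addr0 mul0r !mul1r invr1 mulrC.
  by apply: continuous_cvg idc; exact: Xinf_continuous.
(* [F u] is [Xquad phi a x (c u) u^-1] with denominators cleared: in the two quotients that involve
   [u^-1] the poles of the value at [u^-1] cancel, so every term has a limit at 0. *)
pose F u := (X x - X a) / t - (X (c u) - X x) / (c u - x)
  + Xinf phi u * (c u - a) / ((1 - c u * u) * (1 - a * u))
  - X (c u) * u / (1 - c u * u) + X a * u / (1 - a * u).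
have Fc : F u @[u --> 0^'] --> (X x - X a) / t - (X (x + t) - X x) / t
  + phi (1, 0) / 2 * (x + t - a) / (1 * 1) - X (x + t) * 0 / 1 + X a * 0 / 1.
  apply: cvgD; [apply: cvgB; [apply: cvgD; [apply: cvgB|]|]|].
  - exact: cvg_cst.
  - by apply: cvgM; [apply: cvgB Xc (cvg_cst _)|apply: cvgV].
  - apply: cvgM; first by apply: cvgM Xi _; apply: cvgB cc (cvg_cst _).
    by apply: cvgV; [rewrite mulr1 oner_neq0|apply: cvgM].
  - by apply: cvgM; [apply: cvgM Xc idc|apply: cvgV cuc; exact: oner_neq0].
  - by apply: cvgM; [apply: cvgM (cvg_cst _) idc|apply: cvgV (lin a); exact: oner_neq0].
have Fle : \forall u \near 0^', `|F u| <= N.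
  have u_neq0 := nbhs_dnbhs_neq (0 : R).
  have n1 := cvgr_neq0 _ (lin a) (oner_neq0 R).
  have n2 := cvgr_neq0 _ dc t_neq0.
  have n3 := cvgr_neq0 _ denc (oner_neq0 R).
  have n4 := cvgr_neq0 _ cuc (oner_neq0 R).
  near=> u.
  have u0 : u != 0 by near: u.
  have na : 1 - a * u != 0 by near: u; exact: n1.
  have nc : c u - x != 0 by near: u; exact: n2.
  have nden : den u != 0 by near: u; exact: n3.
  have ncu : 1 - c u * u != 0 by near: u; exact: n4.
  have -> : F u = Xquad phi a x (c u) u^-1.
    rewrite /Xquad -/X (Xcoord_inv _ u0 : X _ = _) /F.
    move: (c u) (X (c u)) nc ncu => C XC nc ncu.
    have E : x - a = t by rewrite /a; ring.
    rewrite E; field.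
    have nau : a * u - 1 != 0 by rewrite -opprB oppr_eq0.
    by rewrite u0 nau mulNr ncu nc t_neq0 na.
  apply: Xquad_le => //; rewrite /cr.
  have E : t * (1 - c u * u) = (c u - x) * (1 - a * u).
    rewrite /c /a; move: nden; rewrite /den => nden; field. done.
  move: (c u) nc ncu E => C nc ncu E.
  rewrite (_ : x - a = t); last by rewrite /a; ring.
  have nua : u^-1 - a != 0.
    by rewrite (_ : u^-1 - a = (1 - a * u) / u) ?mulf_neq0 ?invr_eq0 //; field.
  rewrite (_ : t * (u^-1 - C) = (C - x) * (u^-1 - a)).
    by rewrite divff // mulf_neq0.
  have -> : t * (u^-1 - C) = t * (1 - C * u) / u by field.
  by rewrite E; field.
have F0 : `|(X x - X a) / t - (X (x + t) - X x) / t
  + phi (1, 0) / 2 * (x + t - a) / (1 * 1) - X (x + t) * 0 / 1 + X a * 0 / 1| <= N.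
  exact: (cvgr_to_le (cvg_norm Fc) Fle).
(* The third term of the limit equals [phi (1, 0) * t], the contribution of the subtracted quadratic
   to the second difference, divided by [t]. *)
rewrite -ler_pdivrMr // -[X in _ / X](gtr0_norm t_gt0) -normf_div.
apply: le_trans F0; rewrite le_eqVlt; apply/orP; left; apply/eqP; congr `|_|.
by rewrite -/a /a; field.
Unshelve. all: by end_near.
Qed.

Lemma Xcoord_le phi M K x : (forall z, S1 z -> `|phi z| <= M) -> `|x| <= K ->
  `|Xcoord phi x| <= (K ^+ 2 + 1) / 2 * M.
Proof.
move=> phiM xK; have x2 := sqr1_gt0 x.
rewrite /Xcoord normrM ger0_norm ?divr_ge0 ?(ltW x2) //.
apply: ler_pM => //; first by rewrite divr_ge0 // ltW.
  rewrite ler_pM2r ?invr_gt0 // lerD2r -real_normK ?num_real //.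
  by rewrite lerXn2r ?nnegrE ?(le_trans (normr_ge0 _) xK).
by apply: phiM; exact: cayley_S1.
Qed.

Lemma Xcoord_lp (x : R) s : (x ^+ 2 + 1) / 2 * lp (cayley x) s =
  (- s.1.1 + s.1.2) / 2 * x ^+ 2 - s.2 * x + (- s.1.1 - s.1.2) / 2.
Proof. by rewrite /lp /cayley/=; field; rewrite gt_eqF // sqr1_gt0. Qed.

(* In the upper half-plane, [eta] is [x0 + i * 2 h] and [1 - dot2 eta z] is a
   multiple of [(x - x0) ^ 2 + 4 h ^ 2]; the affine function is chosen to agree
   with [phi] at infinity and at [x0 - h] and [x0 + h]. *)
Lemma affine_approximation phi M N eta : {within @S1 R, continuous phi} ->
  (forall z, S1 z -> `|phi z| <= M) -> 0 <= N -> (cr_norm phi <= N%:E)%E ->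
  D2 eta -> exists s, forall z, S1 z ->
  `|phi z - lp z s| <= 4 * N / (3 * Num.sqrt (1 - sqn2 eta)) * (1 - dot2 eta z).
Proof.
move=> phic phiM N_ge0 phiN D2eta.
have e_gt0 := D2_gap D2eta.
set r := Num.sqrt (1 - sqn2 eta).
have r_gt0 : 0 < r by rewrite sqrtr_gt0.
have rK : r ^+ 2 = 1 - eta.1 ^+ 2 - eta.2 ^+ 2.
  by rewrite /r sqr_sqrtr ?(ltW e_gt0) // /sqn2; ring.
pose e := 1 - eta.1.
have ee_gt0 : 0 < e.
  by rewrite /e; have := exprn_gt0 2 r_gt0; rewrite rK; have := sqr_ge0 eta.2; nra.
have e_neq0 : e != 0 by rewrite gt_eqF.
have r_neq0 : r != 0 by rewrite gt_eqF.
(* In the coordinate [x], [1 - dot2 eta z] is proportional to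
   [e * x ^+ 2 + 2 * eta.2 * x + (1 + eta.1)], whose roots are [x0 + 2 i h] and [x0 - 2 i h]. *)
pose x0 := - eta.2 / e; pose h := r / (2 * e).
have h_gt0 : 0 < h by rewrite divr_gt0 ?mulr_gt0.
have h_neq0 : h != 0 by rewrite gt_eqF.
have h2_gt0 : 0 < 2 * h by rewrite mulr_gt0.
pose V x := Xcoord phi x - phi (1, 0) / 2 * x ^+ 2.
have VN : zygmund N V by exact: Xcoord_zygmund.
(* [V] minus its chord, rescaled so that [x0 - h] and [x0 + h] become 0 and 1; dividing by [2 * h]
   keeps the constant [N]. *)
pose Y y := (V (x0 - h + 2 * h * y)
  - (V (x0 - h) + (V (x0 + h) - V (x0 - h)) * y)) / (2 * h).
have YN : zygmund N Y.
  move=> y t t_gt0; have ht_gt0 : 0 < 2 * h * t by rewrite mulr_gt0 // mulr_gt0.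
  have := VN (x0 - h + 2 * h * y) _ ht_gt0.
  rewrite (_ : x0 - h + 2 * h * y - 2 * h * t = x0 - h + 2 * h * (y - t)); last by ring.
  rewrite (_ : x0 - h + 2 * h * y + 2 * h * t = x0 - h + 2 * h * (y + t)); last by ring.
  set W := (X in `|X| <= _ -> _) => HW.
  have -> : 2 * Y y - Y (y - t) - Y (y + t) = W / (2 * h) by rewrite /W /Y; field.
  rewrite normf_div (gtr0_norm h2_gt0) ler_pdivrMr //.
  by apply: le_trans HW _; rewrite le_eqVlt; apply/orP; left; apply/eqP; ring.
have Y0 : Y 0 = 0 by rewrite /Y !mulr0 !addr0 subrr mul0r.
have Y1 : Y 1 = 0.
  rewrite /Y !mulr1 (_ : x0 - h + 2 * h = x0 + h); last by ring.
  by rewrite addrC (addrC (V _)) subrK addNr mul0r.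
have [B YB] : exists B, forall y, - 1 <= y <= 2 -> `|Y y| <= B.
  pose K := `|x0| + 3 * h.
  pose L := (K ^+ 2 + 1) / 2 * M + `|phi (1, 0) / 2| * K ^+ 2.
  have VL x : `|x| <= K -> `|V x| <= L.
    move=> xK; apply: le_trans (ler_normB _ _) _; apply: lerD; first exact: Xcoord_le.
    rewrite normrM ler_wpM2l // normrX lerXn2r ?nnegrE //.
    exact: le_trans (normr_ge0 _) xK.
  have K_ge x : x0 - 3 * h <= x <= x0 + 3 * h -> `|x| <= K.
    move=> /andP[? ?]; rewrite /K ler_norml.
    have := ler_norm x0; have := ler_norm (- x0); rewrite normrN.
    by move=> *; apply/andP; split; lra.
  exists ((L + (L + (L + L) * 2)) / (2 * h)) => y /andP[y_ge y_le].
  rewrite /Y normf_div (gtr0_norm h2_gt0) ler_pM2r ?invr_gt0 //.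
  have V1 : `|V (x0 - h)| <= L by apply/VL/K_ge/andP; split; lra.
  have V2 : `|V (x0 + h)| <= L by apply/VL/K_ge/andP; split; lra.
  apply: le_trans (ler_normB _ _) _; apply: lerD.
    by apply/VL/K_ge/andP; split; nra.
  apply: le_trans (ler_normD _ _) _; apply: lerD => //.
  rewrite normrM; apply: ler_pM => //.
    by apply: le_trans (ler_normB _ _) _; exact: lerD.
  by rewrite ler_norml; apply/andP; split; lra.
pose l1 := (V (x0 + h) - V (x0 - h)) / (2 * h).
pose l0 := V (x0 - h) - l1 * (x0 - h).
pose c2 := phi (1, 0) / 2.
(* By [Xcoord_lp], the triple of the polynomial [c2 * x ^+ 2 + l1 * x + l0]. *)
exists (- (c2 + l0), c2 - l0, - l1) => z S1z.
have k_ge0 : 0 <= 4 * N / (3 * r) by rewrite divr_ge0 ?mulr_ge0 // ltW.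
have [->|z_neq1] := eqVneq z (1, 0).
  rewrite (_ : phi (1, 0) - _ = 0) ?normr0; last by rewrite /lp/= /c2; field.
  rewrite mulr_ge0 // subr_ge0; apply: dot2_S1 => //.
  by rewrite /S1/= /sqn2/=; ring.
have [x zE] := cayley_surj S1z z_neq1; rewrite zE {z S1z z_neq1 zE}.
have x2 := sqr1_gt0 x.
have x2_gt0 : 0 < (x ^+ 2 + 1) / 2 by rewrite divr_gt0.
rewrite -(ler_pM2l x2_gt0) -{1}(gtr0_norm x2_gt0) -normrM mulrBr Xcoord_lp /=.
rewrite -/(Xcoord phi x).
pose y := (x - x0 + h) / (2 * h).
have xE : x0 - h + 2 * h * y = x by rewrite /y; field.
have -> : Xcoord phi x - ((- - (c2 + l0) + (c2 - l0)) / 2 * x ^+ 2 - - l1 * x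
   + (- - (c2 + l0) - (c2 - l0)) / 2) = 2 * h * Y y.
  by rewrite /Y xE /l0 /l1 /c2 /y /V; field.
rewrite normrM (gtr0_norm h2_gt0).
have Yy := zygmund_le YN N_ge0 Y0 Y1 YB y.
apply: (@le_trans _ _ (2 * h * (2 / 3 * N * (y ^+ 2 - y + 1)))).
  by rewrite ler_wpM2l // mulr_ge0 // ltW.
have -> : (x ^+ 2 + 1) / 2 * (4 * N / (3 * r) * (1 - dot2 eta (cayley x))) =
  N / (3 * h) * ((x - x0) ^+ 2 + 4 * h ^+ 2).
  have A : (x ^+ 2 + 1) / 2 * (1 - dot2 eta (cayley x)) =
           (e * x ^+ 2 + 2 * eta.2 * x + (1 + eta.1)) / 2.
    by rewrite /dot2 /cayley /e /=; field; rewrite gt_eqF.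
  have D : 1 + eta.1 = (eta.2 ^+ 2 + r ^+ 2) / e.
    by rewrite rK /e; field; rewrite -/e.
  by rewrite mulrCA A D /h /x0; field; rewrite r_neq0 e_neq0.
(* The Zygmund bound has its roots at height [sqrt 3 * h] over [x0], below the height [2 * h] of
   [eta], whence [3 * h ^+ 2 <= 4 * h ^+ 2]. *)
have -> : 2 * h * (2 / 3 * N * (y ^+ 2 - y + 1)) =
  N / (3 * h) * ((x - x0) ^+ 2 + 3 * h ^+ 2) by rewrite /y; field.
have Nh_ge0 : 0 <= N / (3 * h).
  by apply: divr_ge0 => //; apply: mulr_ge0 => //; exact: ltW.
by rewrite ler_wpM2l // lerD2l ler_wpM2r ?sqr_ge0 // ler_nat.
Qed.

(** The error bound [k * (1 - dot2 eta z)] is affine in [z], so adding and subtracting it traps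
    [phi] between two affine functions. At [eta] they differ by [2 * k * r ^+ 2], and
    [2 * k * r = 8 / 3 * N]. *)
Lemma width_le_cr_norm phi M : {within @S1 R, continuous phi} ->
  (forall z, S1 z -> `|phi z| <= M) -> (width phi <= (8 / 3)%:E * cr_norm phi)%E.
Proof.
move=> phic phiM.
have cr_ge0 : (0 <= cr_norm phi)%E.
  (* A quadruple of cross-ratio 1, so that the supremum is over a nonempty set. *)
  apply: ereal_sup_ge; exists (`|Xquad phi 0 1 (3 / 2) 3|)%:E.
    by exists 0, 1, (3 / 2), 3; split => //; rewrite /cr; field.
  by rewrite lee_fin normr_ge0.
case NE : (cr_norm phi) cr_ge0 => [N| |] // N_ge0; last first.
  by rewrite gt0_muley ?leey // lte_fin divr_gt0.
rewrite lee_fin in N_ge0.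
apply/ereal_supP => _ [eta D2eta <-]; rewrite -EFinM lee_fin.
have phiN : (cr_norm phi <= N%:E)%E by rewrite NE.
have [s sP] := affine_approximation phic phiM N_ge0 phiN D2eta.
have e_gt0 := D2_gap D2eta.
have rK : Num.sqrt (1 - sqn2 eta) ^+ 2 = 1 - sqn2 eta by rewrite sqr_sqrtr // ltW.
have r_gt0 : 0 < Num.sqrt (1 - sqn2 eta) by rewrite sqrtr_gt0.
move: (Num.sqrt _) rK r_gt0 sP => r rK r_gt0 sP.
have r_neq0 : r != 0 by rewrite gt_eqF.
set k := 4 * N / (3 * r) in sP.
pose up := (s.1.1 - k, s.1.2 - k * eta.1, s.2 - k * eta.2).
pose dn := (s.1.1 + k, s.1.2 + k * eta.1, s.2 + k * eta.2).
have upP : phi_plus phi eta <= lp eta up.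
  apply: (phi_plus_le_lp phiM) => // z /sP; rewrite ler_norml => /andP[_].
  by rewrite /lp /up /dot2 /=; lra.
have dnP : lp eta dn <= phi_minus phi eta.
  apply: (lp_le_phi_minus phiM) => // z /sP; rewrite ler_norml => /andP[+ _].
  by rewrite /lp /dn /dot2 /=; lra.
rewrite ler_pdivrMr //; apply: (@le_trans _ _ (lp eta up - lp eta dn)).
  by rewrite lerB.
rewrite le_eqVlt; apply/orP; left; apply/eqP.
have -> : lp eta up - lp eta dn = 2 * k * r ^+ 2.
  by rewrite rK /lp /up /dn /sqn2 /=; ring.
by rewrite /k; field.
Qed.

End CrossRatioNorm.

Unset Implicit Arguments.

Theorem theorem1p3 (R : realType) (phi : R * R -> R) (left : bool) :
  {within @S1 R, continuous phi} ->
  ((((1 - tanhR 1) / (2 * Num.sqrt 2))%:E * thurston_norm left phi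
      <= width phi)
   /\ (width phi <= (8 / 3)%:E * cr_norm phi))%E.
Proof.
move=> phic; have [M phiM] := S1_bounded phic.
by split; [exact: thurston_norm_le_width phiM|exact: width_le_cr_norm phiM].
Qed.
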